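(* Let $A$ be either $\mathbb{H}$ or $\mathbb{O}$. If $f:A\to A$ is a slice-Nash function on $A$, then $f$ is a slice polynomial function, i.e. there exist an integer $n\ge 0$ and $\alpha_0,\ldots,\alpha_n\in A$ such that $f(x)=\sum_{s=0}^{n}x^s\alpha_s$ for each $x\in A$.
   Context: $\mathbb{H}$ denotes the quaternions and $\mathbb{O}$ the octonions; $\mathbb{S}_A=\{I\in A: I^2=-1\}$. Put $u_A=1$ if $A=\mathbb{H}$ and $u_A=3$ if $A=\mathbb{O}$. The complex field is $\mathbb{C}=\{\alpha+\iota\beta\}$ with $\iota\notin\mathbb{S}_A$. For $I\in\mathbb{S}_A$, $\mathbb{C}_I=\mathbb{R}+\mathbb{R}I$. For $D\subset\mathbb{C}$ invariant under complex conjugation, $\Omega_D=\{\alpha+\beta I:\alpha+\iota\beta\in D,\ I\in\mathbb{S}_A\}$ (so $\Omega_{\mathbb{C}}=A$). Elements of $A\otimes_{\mathbb{R}}\mathbb{C}$ are $x+\iota y$ ($x,y\in A$), with $\overline{x+\iota y}=x-\iota y$. A stem function on an open conjugation-invariant $D\subset\mathbb{C}$ is $F=F_1+\iota F_2:D\to A\otimes_{\mathbb{R}}\mathbb{C}$ with $F(\overline z)=\overline{F(z)}$. It induces the slice function $f=\mathcal{I}(F):\Omega_D\to A$, $f(\alpha+\beta I)=F_1(\alpha+\iota\beta)+I\,F_2(\alpha+\iota\beta)$; every slice function comes from a unique stem function. $f$ is slice regular if $F$ is holomorphic, i.e. $C^1$ with $\frac{\partial F}{\partial\alpha}+\iota\frac{\partial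 F}{\partial\beta}=0$. A function $g:D\to\mathbb{C}$ on an open $D\subset\mathbb{C}$ is complex Nash if every point of $D$ has an open neighbourhood $U\subset D$ on which $g$ is holomorphic and satisfies $P(z,g(z))=0$ for some non-zero $P\in\mathbb{C}[z,t]$. For $I\in\mathbb{S}_A$, $A$ is a $\mathbb{C}_I$-vector space by left multiplication; if $\{1,I_1,\ldots,I_{u_A}\}$ is a base over $\mathbb{C}_I$, then $\{I_0:=1,I,I_1,II_1,\ldots,I_{u_A},II_{u_A}\}$ is called a splitting base of $A$ associated to $I$. Write uniquely $F_s=\sum_{k=0}^{u_A}(F_{s,1}^{I,I_k}+F_{s,2}^{I,I_k}I)I_k$ ($s=1,2$) with real-valued coefficients, and $F^{\ell}_{I,I_k}=F_{1,\ell}^{I,I_k}+\iota F_{2,\ell}^{I,I_k}:D\to\mathbb{C}$ ($\ell=1,2$). $F$ is stem-Nash on $D$ if for some $I$ and some splitting base associated to $I$ all $F^{\ell}_{I,I_k}$ are complex Nash on $D$. $f=\mathcal{I}(F)$ is slice-Nash on $\Omega_D$ if it is slice regular and $F$ is stem-Nash on $D$. *)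

(* Defs.v *)
From HB Require Import structures.
From mathcomp Require Import all_boot all_order all_algebra polyXY.
From mathcomp Require Import all_classical all_reals all_analysis.
From mathcomp.real_closed Require Import complex.

Set Implicit Arguments.
Unset Strict Implicit.
Unset Printing Implicit Defensive.

Import Order.TTheory GRing.Theory Num.Theory numFieldNormedType.Exports.

Local Open Scope classical_set_scope.
Local Open Scope ring_scope.

(* Finite-dimensional real algebras with conjugation, not necessarily
   associative; they carry the topology of the underlying normed space. *)
Record starAlg (R : realType) := StarAlg {
  sa_car :> normedModType R;
  sa_one : sa_car;
  sa_mul : sa_car -> sa_car -> sa_car;
  sa_conj : sa_car -> sa_car }.

Arguments sa_one {R s}.
Arguments sa_mul {R s}.
Arguments sa_conj {R s}.

Definition real_starAlg (R : realType) : starAlg R :=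
  @StarAlg R (R^o : normedModType R) 1 (fun x y => x * y) id.

(* Cayley-Dickson doubling:
   (a, b) (c, d) = (a c - d^* b, d a + b c^* ),  (a, b)^* = (a^*, - b). *)
Definition cayley_dickson (R : realType) (A : starAlg R) : starAlg R :=
  @StarAlg R ((A * A)%type : normedModType R) (sa_one, 0)
    (fun x y => (sa_mul x.1 y.1 - sa_mul (sa_conj y.2) x.2,
                 sa_mul y.2 x.1 + sa_mul x.2 (sa_conj y.1)))
    (fun x => (sa_conj x.1, - x.2)).

Inductive HorO := Quaternions | Octonions.

Definition alg (R : realType) (h : HorO) : starAlg R :=
  match h with
  | Quaternions => cayley_dickson (cayley_dickson (real_starAlg R))
  | Octonions =>
      cayley_dickson (cayley_dickson (cayley_dickson (real_starAlg R)))
  end.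

(* u_A, that is, dim_R A = 2 (u_A + 1) *)
Definition u_ (h : HorO) : nat :=
  match h with Quaternions => 1%N | Octonions => 3%N end.

(* The powers are unambiguous since H and O are power-associative. *)
Fixpoint sa_exp (R : realType) (A : starAlg R) (x : A) (n : nat) : A :=
  match n with
  | 0%N => sa_one
  | m.+1 => sa_mul x (sa_exp x m)
  end.

Section SliceFunctions.
Variables (R : realType) (h : HorO).

(* The alias ^o gives R[i] its usual topology and its structure of a normed
   space over itself: derivability on C is complex derivability. *)
Local Notation C := (R[i]^o).
Local Notation A := (alg R h).

Definition imaginary_units : set A :=
  [set I | sa_mul I I = - sa_one].

(* alpha + beta I *)
Definition slice_point (I : A) (a b : R) : A := a *: sa_one + b *: I.

Definition slice_plane (I : A) : set A :=
  [set x | exists a b : R, x = slice_point I a b].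

Definition conj_invariant (D : set C) : Prop :=
  forall z : C, D z -> D (conjc z).

(* x + iota y in the complexification of A is encoded as the pair (x, y). *)
Definition cplx_conj (w : A * A) : A * A := (w.1, - w.2).
Definition cplx_iota (w : A * A) : A * A := (- w.2, w.1).

(* Functions on D are total functions whose values outside D are ignored. *)
Definition stem_function (D : set C) (F : C -> A * A) : Prop :=
  [/\ open D, conj_invariant D &
      forall z : C, D z -> F (conjc z) = cplx_conj (F z)].

(* f = I(F) on Omega_D *)
Definition induced_by (D : set C) (F : C -> A * A) (f : A -> A) : Prop :=
  forall (a b : R) (I : A), D (a +i* b)%C -> imaginary_units I ->
    f (slice_point I a b)
    = (F (a +i* b)%C).1 + sa_mul I (F (a +i* b)%C).2.

Definition along_alpha (F : C -> A * A) (z : C) : R -> A * A :=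
  fun a => F (a +i* complex.Im z)%C.
Definition along_beta (F : C -> A * A) (z : C) : R -> A * A :=
  fun b => F (complex.Re z +i* b)%C.

Definition d_alpha (F : C -> A * A) (z : C) : A * A :=
  derive1 (along_alpha F z) (complex.Re z).
Definition d_beta (F : C -> A * A) (z : C) : A * A :=
  derive1 (along_beta F z) (complex.Im z).

Definition C1_on (D : set C) (F : C -> A * A) : Prop :=
  forall z : C, D z ->
    [/\ derivable (along_alpha F z) (complex.Re z) 1,
        derivable (along_beta F z) (complex.Im z) 1,
        {for z, continuous (d_alpha F)} &
        {for z, continuous (d_beta F)}].

Definition stem_holomorphic (D : set C) (F : C -> A * A) : Prop :=
  C1_on D F /\
  forall z : C, D z -> d_alpha F z + cplx_iota (d_beta F z) = 0.

(* P.[z, w] evaluates P, a polynomial in two variables, at (z, w). *)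
Definition complex_Nash (D : set C) (g : C -> C) : Prop :=
  forall z0 : C, D z0 ->
    exists U : set C,
      [/\ open U, U z0, U `<=` D,
          (forall z : C, U z -> derivable g z 1) &
          exists P : {poly {poly R[i]}},
            P != 0 /\ forall z : C, U z -> P.[z : R[i], g z : R[i]] = 0].

(* e = (I_0, ..., I_{u_A}) with I_0 = 1 is a basis of A over C_I, acting by
   left multiplication; the splitting base is {I_k, I I_k | k <= u_A}. *)
Definition splitting_base (I : A) (e : 'I_(u_ h).+1 -> A) : Prop :=
  [/\ e ord0 = sa_one,
      (forall x : A, exists c : 'I_(u_ h).+1 -> A,
         (forall k, slice_plane I (c k)) /\
         x = \sum_k sa_mul (c k) (e k)) &
      (forall c : 'I_(u_ h).+1 -> A, (forall k, slice_plane I (c k)) ->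
         \sum_k sa_mul (c k) (e k) = 0 -> forall k, c k = 0)].

(* phi1 l k and phi2 l k are the real coordinates of F_1 and F_2 in the
   splitting base: l = false for the coefficient of I_k and l = true for that
   of I I_k. They are uniquely determined by F on D. *)
Definition stem_Nash (D : set C) (F : C -> A * A) : Prop :=
  exists (I : A) (e : 'I_(u_ h).+1 -> A),
    [/\ imaginary_units I, splitting_base I e &
        exists phi1 phi2 : bool -> 'I_(u_ h).+1 -> C -> R,
          [/\ (forall z : C, D z ->
                 (F z).1 = \sum_k sa_mul
                   (slice_point I (phi1 false k z) (phi1 true k z)) (e k)),
              (forall z : C, D z ->
                 (F z).2 = \sum_k sa_mul
                   (slice_point I (phi2 false k z) (phi2 true k z)) (e k)) &
              forall l k,
                complex_Nash D (fun z => (phi1 l k z +i* phi2 l k z)%C)]].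

(* Omega_D is all of A when D = setT, so slice_Nash setT f says that f is
   slice-Nash on A. *)
Definition slice_Nash (D : set C) (f : A -> A) : Prop :=
  exists F : C -> A * A,
    [/\ stem_function D F, induced_by D F f, stem_holomorphic D F &
        stem_Nash D F].

End SliceFunctions.

(* Main.v *)
Require Import Defs.
From HB Require Import structures.
From mathcomp Require Import all_boot all_order all_algebra polyXY.
From mathcomp Require Import all_classical all_reals all_analysis.
From mathcomp.real_closed Require Import complex.
From mathcomp Require Import ring lra.

(** An entire function g with P(z, g(z)) = 0 locally is a polynomial, by
    Liouville's theorem; no integration is used.  Call g tame if it is
    continuous and has a second order Taylor expansion at all points of some
    punctured neighbourhood of every point.  A locally algebraic function is
    tame: divide P by its multiple factors and solve P(z, g(z)) = 0 to second
    order away from the zeros of the resultant of P and its derivative.  Tame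
    functions satisfy the maximum principle, because |g|^2 + eps |z|^2 has
    positive Laplacian.  Applied to g / z^m, it shows that a tame function
    vanishing on an open set is zero, so that P(z, g(z)) = 0 holds everywhere
    and g has polynomial growth; applied to iterated difference quotients of
    g, it shows that a tame function of polynomial growth is a polynomial.

    The components of the stem function in a splitting base are therefore
    polynomials.  Averaging with F(conj z) = conj F(z) makes the coefficients
    real, and a real multiple of z^s induces the slice function x^s up to the
    same multiple. *)

Set Implicit Arguments.
Unset Strict Implicit.
Unset Printing Implicit Defensive.

Import Order.TTheory GRing.Theory Num.Theory numFieldNormedType.Exports.
Import ComplexField.Normc.

Local Open Scope classical_set_scope.
Local Open Scope ring_scope.

(** * Topology of the complex plane through the real-valued modulus *)

Section PlaneTopology.
Variable R : realType.
Local Notation C := (R[i]^o).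

Lemma normE (z : C) : `|z| = (normc z)%:C%C.
Proof. by []. Qed.

Lemma normcX (z : C) n : normc (z ^+ n) = normc z ^+ n.
Proof.
elim: n => [|n IH]; first by rewrite !expr0 normc1.
by rewrite !exprS normcM IH.
Qed.

Lemma normc_ge0 (z : C) : 0 <= normc z.
Proof. by case: z => a b; exact: sqrtr_ge0. Qed.

Lemma normc_gt0 (z : C) : (0 < normc z) = (z != 0).
Proof.
rewrite lt_neqAle normc_ge0 andbT eq_sym; apply/idP/idP.
  by apply: contraNneq => ->; rewrite normc0.
by apply: contraNneq => /eq0_normc ->.
Qed.

Lemma gt0_complexP (e : C) : 0 < e -> exists2 d : R, 0 < d & e = d%:C%C.
Proof.
by case: e => a b; rewrite ltcE /= => /andP[/eqP -> a0]; exists a.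
Qed.

Lemma near_normc (z : C) (P : C -> Prop) :
  (\forall w \near z, P w) <->
  exists2 d : R, 0 < d & forall w, normc (w - z) < d -> P w.
Proof.
split.
  case/nbhs_ballP => e /= /gt0_complexP[d d0 ->] H; exists d => // w hw.
  by apply: H; rewrite /ball /= distrC normE ltcR.
case=> d d0 H; apply/nbhs_ballP; exists d%:C%C => /=; first by rewrite ltcR.
by move=> w; rewrite /ball /= distrC normE ltcR => /H.
Qed.

Lemma normc_continuous : continuous (fun z : C => normc z : R).
Proof.
move=> z; apply/(@cvgrPdist_lt _ _ _ _ (nbhs_filter _)) => e e0.
apply: (proj2 (near_normc z _)); exists e => // w hw.
apply: le_lt_trans hw; rewrite ler_norml; apply/andP; split.
  by rewrite lerNl opprB lerBlDr -{1}(subrK z w) le_normcD.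
by rewrite lerBlDr -(normcN (w - z)) opprB -{1}(subrK w z) le_normcD.
Qed.

Lemma complex_continuous : continuous (fun p : R * R => (p.1 +i* p.2)%C : C).
Proof.
move=> [x y]; apply/cvgrPdist_lt => e e0.
have [d d0 ->] := gt0_complexP e0.
near=> p.
rewrite normE ltcR.
have -> : (x +i* y - (p.1 +i* p.2) = (x - p.1)%:C + 'i * (y - p.2)%:C)%C.
  by simpc.
apply: le_lt_trans (le_normcD _ _) _.
rewrite normcM /= !(expr0n, expr1n, addr0, add0r) /= !sqrtr_sqr sqrtr1 mul1r.
rewrite [ltRHS](splitr) ltrD //.
  near: p; apply: (@cvgr_dist_lt _ _ _ _ _ (fun p : R * R => p.1)).
    exact: cvg_fst.
  by rewrite divr_gt0.
near: p; apply: (@cvgr_dist_lt _ _ _ _ _ (fun p : R * R => p.2)).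
  exact: cvg_snd.
by rewrite divr_gt0.
Unshelve. all: by end_near. Qed.

Lemma continuous_normcP (f : C -> C) (z : C) :
  {for z, continuous f} <->
  forall e : R, 0 < e -> exists2 d : R, 0 < d &
    forall w, normc (w - z) < d -> normc (f w - f z) < e.
Proof.
split=> [cf e e0|cf].
  apply: (proj1 (near_normc z (fun w => normc (f w - f z) < e))).
  have := cf _ (proj2 (near_normc (f z) (fun w => normc (w - f z) < e)) _).
  by apply; exists e.
apply/(@cvgrPdist_lt _ _ _ _ (nbhs_filter _)) => _ /gt0_complexP[e e0 ->].
apply: (proj2 (near_normc z _)).
have [d d0 H] := cf e e0; exists d => // w /H.
by rewrite distrC normE ltcR.
Qed.

Definition disc (r : R) : set C := [set z : C | normc z <= r].

Lemma normc_geRe (z : C) : `|complex.Re z| <= normc z.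
Proof. by have := normc_ge_Re z; rewrite normE lecR. Qed.

Lemma normc_geIm (z : C) : `|complex.Im z| <= normc z.
Proof.
case: z => a b /=; rewrite -sqrtr_sqr ler_sqrt ?addr_ge0 ?sqr_ge0 //.
by rewrite lerDr sqr_ge0.
Qed.

(** The disc is closed inside the image of the compact square [-r, r]^2. *)
Lemma disc_compact r : compact (disc r).
Proof.
pose sq : set C := (fun p : R * R => (p.1 +i* p.2)%C : C)
  @` (`[- r, r]%classic `*` `[- r, r]%classic).
have csq : compact sq.
  apply: continuous_compact.
    by apply: continuous_subspaceT; exact: complex_continuous.
  by apply: compact_setX; apply: segment_compact.
apply: subclosed_compact csq _.
  apply: (@closed_comp _ _ (fun z : C => normc z) [set x | x <= r]).
    by move=> ? _; exact: normc_continuous.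
  exact: closed_le.
move=> z zr; exists (complex.Re z, complex.Im z) => /=; last by case: (z).
have := le_trans (normc_geRe z) zr; have := le_trans (normc_geIm z) zr.
by rewrite !in_itv /= !ler_norml.
Qed.

End PlaneTopology.

(** * Continuity at a point *)

Section Continuity.
Variable R : realType.
Local Notation C := (R[i]^o).
Implicit Types (f g : C -> C) (z w : C).

(* A constant instead of the bare notation, so that unification against it is
   syntactic and does not unfold the filters. *)
Definition cont_at f z := {for z, continuous f}.

Lemma cont_atD f g z : cont_at f z -> cont_at g z -> cont_at (fun x => f x + g x) z.
Proof. by move=> cf cg; exact: (cvgD cf cg). Qed.

Lemma cont_atM f g z : cont_at f z -> cont_at g z -> cont_at (fun x => f x * g x) z.
Proof. by move=> cf cg; exact: (cvgM cf cg). Qed.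

Lemma cont_atV f z : f z != 0 -> cont_at f z -> cont_at (fun x => (f x)^-1) z.
Proof. by move=> fz cf; exact: (@cvgV _ _ _ _ _ _ fz cf). Qed.

Lemma cont_at_cst (c : C) z : cont_at (fun=> c) z.
Proof. by move=> A; exact: (@cvg_cst _ c _ (nbhs z) _ A). Qed.

Lemma cont_at_id z : cont_at (fun x => x) z.
Proof. by []. Qed.

Lemma cont_at_comp f g z : cont_at g z -> cont_at f (g z) -> cont_at (fun x => f (g x)) z.
Proof. by move=> cg cf; exact: (continuous_comp cg cf). Qed.

End Continuity.

Ltac prove_cont_at := repeat lazymatch goal with
  | |- cont_at (fun x => x) _ => exact: cont_at_id
  | |- cont_at (fun=> ?c) _ => exact: cont_at_cst
  | |- cont_at (fun x => @?f x + @?g x) _ => refine (@cont_atD _ f g _ _ _)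
  | |- cont_at (fun x => @?f x * @?g x) _ => refine (@cont_atM _ f g _ _ _)
  | |- cont_at (fun x => ?f x) _ => refine (_ : cont_at f _)
  | H : cont_at ?f ?z |- cont_at ?f ?z => exact H
  end.

(** * Second order jets and tame functions *)

Section Jets.
Variable R : realType.
Local Notation C := (R[i]^o).
Implicit Types (f g : C -> C) (z w : C).

(* A second order Taylor expansion at z, in the style of Caratheodory. *)
Definition jet g z := exists (a : C) (phi : C -> C),
  cont_at phi 0 /\
  \forall h \near (0 : C), g (z + h) = g z + a * h + h ^+ 2 * phi h.

Lemma jet_near f g z : (\forall x \near z, f x = g x) -> jet f z -> jet g z.
Proof.
move=> fg [a [phi [cphi H]]]; exists a, phi; split => //.
case: (proj1 (near_normc _ _) fg) => d d0 {}fg.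
have fgz : f z = g z by apply: fg; rewrite subrr normc0.
case: (proj1 (near_normc _ _) H) => e e0 {}H.
apply: (proj2 (near_normc _ _)); exists (Num.min d e).
  by rewrite lt_min d0.
move=> h; rewrite lt_min => /andP[hd /H]; rewrite -fgz => <-.
by rewrite fg // addrC addKr -[h]subr0.
Qed.

Lemma jet_cst (c : C) z : jet (fun=> c) z.
Proof.
exists 0, (fun=> 0); split; first exact: cont_at_cst.
by apply: (@nearW _ (nbhs (0 : C))) => h; rewrite mul0r mulr0 !addr0.
Qed.

Lemma jet_id z : jet (fun x => x) z.
Proof.
exists 1, (fun=> 0); split; first exact: cont_at_cst.
by apply: (@nearW _ (nbhs (0 : C))) => h; rewrite mul1r mulr0 !addr0.
Qed.

Lemma jetD f g z : jet f z -> jet g z -> jet (fun x => f x + g x) z.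
Proof.
move=> [a [phi [cphi Hf]]] [b [psi [cpsi Hg]]].
exists (a + b), (fun h => phi h + psi h); split; first by prove_cont_at.
by move: Hf Hg; apply: (@filterS2 _ (nbhs (0 : C)) _) => h -> ->; ring.
Qed.

Lemma jetM f g z : jet f z -> jet g z -> jet (fun x => f x * g x) z.
Proof.
move=> [a [phi [cphi Hf]]] [b [psi [cpsi Hg]]].
exists (f z * b + a * g z), (fun h => f z * psi h + g z * phi h + a * b
  + h * (a * psi h + b * phi h) + h * h * (phi h * psi h)); split.
  by prove_cont_at.
by move: Hf Hg; apply: (@filterS2 _ (nbhs (0 : C)) _) => h -> ->; ring.
Qed.

Lemma jetV z : z != 0 -> jet (fun x => x^-1) z.
Proof.
(* The remainder comes from the exact identity 1/(z+h) = 1/z - h/z^2 + h^2 / (z^2 (z+h)). *)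
move=> z0; exists (- z ^- 2), (fun h => (z ^+ 2 * (z + h))^-1); split.
  apply: (@cont_atV _ (fun h => z ^+ 2 * (z + h))); last by prove_cont_at.
  by rewrite addr0 mulf_neq0 // expf_neq0.
apply: (proj2 (near_normc _ _)); exists (normc z).
  by rewrite normc_gt0.
move=> h; rewrite subr0 => hz.
have zh : z + h != 0.
  by apply: contraTneq hz => /addr0_eq <-; rewrite normcN ltxx.
by field; rewrite zh z0.
Qed.

Lemma jet_shift g c z : jet g (z + c) -> jet (fun x => g (x + c)) z.
Proof.
move=> [a [phi [cphi H]]]; exists a, phi; split => //.
by apply: (@filterS _ (nbhs (0 : C)) _) H => h <-; rewrite addrAC.
Qed.

(** The centre z is exempt for two reasons: nothing is known about an algebraic function at the
    zeros of its resultant beyond continuity, and dividing by z - w lowers the order of the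
    expansion at w by one. *)
Definition tame g := (forall z, cont_at g z) /\
  forall z, exists2 d : R, 0 < d &
    forall w, w != z -> normc (w - z) < d -> jet g w.

Lemma tame_cst (c : C) : tame (fun=> c).
Proof.
split=> [z|z]; first exact: cont_at_cst.
by exists 1 => // w _ _; exact: jet_cst.
Qed.

Lemma tame_id : tame (fun x => x).
Proof.
split=> [z|z]; first exact: cont_at_id.
by exists 1 => // w _ _; exact: jet_id.
Qed.

Lemma tameD f g : tame f -> tame g -> tame (fun x => f x + g x).
Proof.
move=> [cf jf] [cg jg]; split=> z; first exact: cont_atD.
have [d d0 Hd] := jf z; have [e e0 He] := jg z.
exists (Num.min d e); first by rewrite lt_min d0.
by move=> w wz; rewrite lt_min => /andP[wd we]; apply: jetD; auto.
Qed.

Lemma tameM f g : tame f -> tame g -> tame (fun x => f x * g x).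
Proof.
move=> [cf jf] [cg jg]; split=> z; first exact: cont_atM.
have [d d0 Hd] := jf z; have [e e0 He] := jg z.
exists (Num.min d e); first by rewrite lt_min d0.
by move=> w wz; rewrite lt_min => /andP[wd we]; apply: jetM; auto.
Qed.

Lemma tameX f n : tame f -> tame (fun x => f x ^+ n).
Proof.
move=> tf; elim: n => [|n IH]; first exact: tame_cst.
by under eq_fun do rewrite exprS; exact: tameM.
Qed.

Lemma tame_horner (p : {poly R[i]}) : tame (fun x => p.[x]).
Proof.
elim/poly_ind: p => [|p c IH].
  by under eq_fun do rewrite horner0; exact: tame_cst.
under eq_fun do rewrite hornerMXaddC.
exact: (tameD (tameM IH tame_id) (tame_cst c)).
Qed.

(** The outer variable receives g x and the coefficients are polynomials in x, so that [deriv]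
    differentiates in the direction of the value. This reverses the order in [complex_Nash];
    [swapXY] passes between the two. *)
Lemma tame_horner2 (P : {poly {poly R[i]}}) g : tame g ->
  tame (fun x => P.[g x : R[i], x : R[i]]).
Proof.
move=> tg; elim/poly_ind: P => [|P c IH].
  by under eq_fun do rewrite !(horner0, hornerC); exact: tame_cst.
under eq_fun do rewrite hornerMXaddC hornerD hornerM hornerC.
exact: (tameD (tameM IH tg) (tame_horner c)).
Qed.

(** The value of g1 at w is the linear coefficient a of the jet: since g1 (w + h) = a + h phi(h) for
    small non-zero h, g1 is continuous at w. The point w merely joins the exceptional points of
    g1. *)
Lemma tame_quotient g w : tame g -> jet g w ->
  exists2 g1, tame g1 & forall z, g z = g w + (z - w) * g1 z.
Proof.
move=> [cg jg] [a [phi [cphi H]]].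
pose q (z : C) := (g z - g w) * (z - w)^-1 : C.
pose g1 z := if z == w then a else q z.
have g1q z : z != w -> \forall x \near z, q x = g1 x.
  move=> zw; apply: (proj2 (near_normc _ _)); exists (normc (z - w)).
    by rewrite normc_gt0 subr_eq0.
  move=> x hx; rewrite /g1; case: eqP => // xw; move: hx.
  by rewrite xw -normcN opprB ltxx.
have cq z : z != w -> cont_at q z.
  move=> zw; apply: (@cont_atM _ (fun x => g x - g w) (fun x => (x - w)^-1)).
    by have cgz := cg z; prove_cont_at.
  by apply: (@cont_atV _ (fun x => x - w)); [rewrite subr_eq0|prove_cont_at].
exists g1; last first.
  move=> z; rewrite /g1 /q; case: eqP => [->|/eqP zw].
    by rewrite subrr mul0r addr0.
  by rewrite mulrC divfK ?subr_eq0 // addrC subrK.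
split=> z.
  have [->{z}|zw] := eqVneq z w; last first.
    apply/continuous_normcP => e e0.
    have /continuous_normcP/(_ e e0)[d d0 H1] := cq _ zw.
    case: (proj1 (near_normc _ _) (g1q _ zw)) => d' d'0 H2.
    exists (Num.min d d'); first by rewrite lt_min d0.
    move=> x; rewrite lt_min => /andP[xd xd'].
    by rewrite -!H2 //; [exact: H1|rewrite subrr normc0].
  have /continuous_normcP cp : cont_at (fun h : C => h * phi h) 0.
    by prove_cont_at.
  apply/continuous_normcP => e e0; have [d d0 H1] := cp e e0.
  case: (proj1 (near_normc _ _) H) => d' d'0 H2.
  exists (Num.min d d'); first by rewrite lt_min d0.
  move=> x; rewrite lt_min => /andP[xd xd'].
  rewrite /g1 eqxx; case: eqP => [_|/eqP xw]; first by rewrite subrr normc0.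
  have := H2 (x - w); rewrite subr0 => /(_ xd').
  rewrite addrC subrK => E.
  have -> : q x - a = (x - w) * phi (x - w).
    by rewrite /q E; field; rewrite subr_eq0.
  by have := H1 (x - w); rewrite subr0 mul0r subr0; apply.
have [d d0 Hd] := jg z.
(* The punctured neighbourhood is shrunk to miss w, where g1 may have no jet. *)
have [d' d'0 Hd'] : exists2 d' : R, 0 < d' &
    forall x, x != z -> normc (x - z) < d' -> x != w.
  have [->|zw] := eqVneq z w; first by exists 1.
  exists (normc (w - z)); first by rewrite normc_gt0 subr_eq0 eq_sym.
  by move=> x _; apply: contraTneq => ->; rewrite ltxx.
exists (Num.min d d'); first by rewrite lt_min d0.
move=> x xz; rewrite lt_min => /andP[xd xd'].
have xw := Hd' x xz xd'.
apply: jet_near (g1q _ xw) _; apply: jetM.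
  by apply: jetD (Hd x xz xd) _; exact: jet_cst.
by apply: (@jet_shift (fun x => x^-1)); apply: jetV; rewrite subr_eq0.
Qed.

End Jets.

(** * Jets of implicit and of algebraic functions *)

Section ImplicitJets.
Variable R : realType.
Local Notation C := (R[i]^o).
Implicit Types (f g : C -> C) (z w : C).

(** Caratheodory's form of the derivative: the difference quotient becomes continuous at 0 when it
    is given the derivative as its value there. *)
Lemma derivable_slope g z : derivable g z 1 ->
  exists2 al : C -> C, cont_at al 0 &
    forall h, g (z + h) = g z + h * al h.
Proof.
move=> dg; pose l := lim (h^-1 *: (g (h *: (1 : C) + z) - g z) @[h --> (0 : C)^']).
pose al (h : C) : C := if h == 0 then l else h^-1 * (g (z + h) - g z).
exists al => [|h]; last first.
  rewrite /al; case: eqP => [->|/eqP h0]; first by rewrite mul0r !addr0.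
  by rewrite mulrA divff // mul1r [RHS]addrC subrK.
apply/continuous_normcP => e e0.
have : \forall h \near (0 : C)^', normc (h^-1 *: (g (h *: (1 : C) + z) - g z) - l) < e.
  apply: (dg (fun w : C => normc (w - l) < e)).
  by apply: (proj2 (near_normc _ _)); exists e.
case/(proj1 (near_normc _ _)) => d d0 H; exists d => // h hd.
rewrite /al eqxx; case: eqP => [_|/eqP h0]; first by rewrite subrr normc0.
by have := H h hd h0; rewrite scaler1 [h + z]addrC.
Qed.

Lemma jet_horner (p : {poly R[i]}) z : jet (fun x => p.[x]) z.
Proof.
elim/poly_ind: p => [|p c IH].
  by under eq_fun do rewrite horner0; exact: jet_cst.
under eq_fun do rewrite hornerMXaddC.
exact: (jetD (jetM IH (jet_id z)) (jet_cst c z)).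
Qed.

(** A is the partial derivative of P in the coefficient variable. The term in h * al h is kept
    exact, rather than replaced by its first order part, so that the equation P = 0 can be solved
    for al h. *)
Lemma horner2_expansion (P : {poly {poly R[i]}}) g z (al : C -> C) :
  cont_at al 0 -> (forall h, g (z + h) = g z + h * al h) ->
  exists (A : C) (psi : C -> C), cont_at psi 0 /\
    \forall h \near (0 : C), P.[g (z + h) : R[i], z + h : R[i]] =
      P.[g z : R[i], z : R[i]] + h * A + P^`().[g z : R[i], z : R[i]] * (h * al h)
      + h ^+ 2 * psi h.
Proof.
move=> cal gE; elim/poly_ind: P => [|P c [A [psi [cpsi IH]]]].
  exists 0, (fun=> 0); split; first exact: cont_at_cst.
  by apply: (@nearW _ (nbhs (0 : C))) => h; rewrite deriv0 !(horner0, hornerC); ring.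
have [b [phi [cphi Hc]]] := jet_horner c z.
exists (A * g z + b), (fun h => psi h * (g z + h * al h) + A * al h
  + P^`().[g z : R[i], z : R[i]] * al h * al h + phi h); split.
  by prove_cont_at.
move: IH Hc; apply: (@filterS2 _ (nbhs (0 : C)) _) => h.
rewrite derivMXaddC !(hornerMXaddC, hornerD, hornerM, hornerX, hornerC) => -> ->.
by rewrite gE; ring.
Qed.

(** Dividing the expansion of P = 0 by h gives A + B al(h) + h psi(h) = 0. Solving for al(h) turns
    the first order formula g z + h al(h) into a second order one with remainder - psi(h) / B. *)
Lemma implicit_jet (P : {poly {poly R[i]}}) g z : derivable g z 1 ->
  (\forall x \near z, P.[g x : R[i], x : R[i]] = 0) ->
  P^`().[g z : R[i], z : R[i]] != 0 -> jet g z.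
Proof.
move=> /derivable_slope[al cal gE] PE; set B := P^`().[_, _] => B0.
have [A [psi [cpsi H]]] := horner2_expansion P cal gE.
have {}PE : \forall h \near (0 : C), P.[g (z + h) : R[i], z + h : R[i]] = 0.
  case: (proj1 (near_normc _ _) PE) => d d0 {}PE.
  apply: (proj2 (near_normc _ _)); exists d => // h; rewrite subr0 => hd.
  by apply: PE; rewrite addrC addKr.
have PE0 : P.[g z : R[i], z : R[i]] = 0.
  case: (proj1 (near_normc _ _) PE) => d d0 /(_ 0).
  by rewrite subrr normc0 addr0; exact.
exists (- A / B), (fun h => psi h * (- B^-1)); split.
  by prove_cont_at.
move: PE H; apply: (@filterS2 _ (nbhs (0 : C)) _) => h -> E.
rewrite gE; have [->|h0] := eqVneq h 0; first by rewrite expr0n /=; ring.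
move: E; rewrite PE0 -/B add0r => E.
have {}E : A + B * al h + h * psi h = 0.
  apply: (mulfI h0); rewrite mulr0 {1}E; ring.
have -> : al h = - (A + h * psi h) / B.
  apply: (mulfI B0); rewrite mulrCA divff // mulr1; apply/eqP.
  by rewrite -addr_eq0 -E; apply/eqP; ring.
by field.
Qed.

End ImplicitJets.

(** If t is a root of P of order m+1 but not a root of Q, then (X - t)^(m+1) divides D, hence P'. In
    characteristic zero the order of t in P' is exactly m, a contradiction. The scalars c and d
    leave room for pseudo-division. *)
Lemma root_squarefree_part (F : numFieldType) (P Q D E : {poly F}) (c d t : F) :
  P != 0 -> c != 0 -> d != 0 -> c *: P = Q * D -> d *: P^`() = E * D ->
  root P t -> root Q t.
Proof.
move=> P0 c0 d0 QD ED Pt; apply: contraT => Qt.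
case: (multiplicity_XsubC P t) => m [W]; rewrite P0 /= => Wt PE.
case: m PE => [|m] PE.
  by move: Pt; rewrite PE expr0 mulr1 (negPf Wt).
have XD : ('X - t%:P) ^+ m.+1 %| D.
  have cop : coprimep (('X - t%:P) ^+ m.+1) Q.
    by rewrite coprimep_expl // coprimep_sym coprimep_XsubC.
  by rewrite -(Gauss_dvdpr _ cop) -QD dvdpZr // PE dvdp_mull.
have : ('X - t%:P) ^+ m.+1 %| P^`().
  by rewrite -(dvdpZr _ _ d0) ED dvdp_mull.
rewrite PE derivM dvdp_addr; last exact: dvdp_mull.
rewrite deriv_exp derivXsubC mul1r /= exprS.
rewrite mulrnAr -mulrnAl dvdp_mul2r ?expf_neq0 ?polyXsubC_eq0 //.
rewrite -scaler_nat dvdpZr ?pnatr_eq0 // dvdp_XsubCl.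
by rewrite (negPf Wt).
Qed.

Lemma root_horner2E (K : comNzRingType) (P : {poly {poly K}}) (x t : K) :
  P.[t, x] = (map_poly (horner_eval x) P).[t].
Proof.
rewrite -[X in (map_poly _ P).[X]](hornerC t x).
exact: (esym (horner_map (horner_eval x) P t%:P)).
Qed.

Section AlgebraicJets.
Variable R : realType.
Local Notation C := (R[i]^o).
Implicit Types (f g : C -> C) (z w : C).

Lemma cont_at_neq0 f z : cont_at f z -> f z != 0 -> \forall x \near z, f x != 0.
Proof.
move=> /continuous_normcP cf fz.
have [|d d0 H] := cf (normc (f z)); first by rewrite normc_gt0.
apply: (proj2 (near_normc _ _)); exists d => // x /H.
by apply: contraTneq => ->; rewrite sub0r normcN ltxx.
Qed.

Lemma cont_at_horner (p : {poly R[i]}) z : cont_at (fun x => p.[x]) z.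
Proof. by have [H _] := tame_horner p; exact: H. Qed.

(** Induction on the degree in the outer variable: either P and P' are coprime and [implicit_jet]
    applies, or P is replaced by its quotient by gcd(P, P'). The polynomial c collects everything
    that must not vanish at z. *)
Lemma algebraic_jet (P : {poly {poly R[i]}}) : P != 0 ->
  exists2 c : {poly R[i]}, c != 0 & forall g z, c.[z : R[i]] != 0 ->
    derivable g z 1 -> (\forall x \near z, P.[g x : R[i], x : R[i]] = 0) ->
    jet g z.
Proof.
elim/ltn_ind: {P}(size P) {-2}P (erefl (size P)) => n IH P sP P0.
have near0 (g : C -> C) z : (\forall x \near z, P.[g x : R[i], x : R[i]] = 0) ->
    P.[g z : R[i], z : R[i]] = 0.
  by case/(proj1 (near_normc _ _)) => d d0; apply; rewrite subrr normc0.
have [u /eqpP[[c1 c2] /= /andP[c10 c20] bez]] := Bezoutp P P^`().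
set D := gcdp P P^`() in bez *.
have D0 : D != 0 by rewrite gcdp_eq0 negb_and P0.
(* Coprime case: by Bezout c2 * d is a combination of P and P', and so acts as a resultant. Where it
   is non-zero, P and P' have no common root. *)
have [D1|D1] := leqP (size D) 1.
  have [d d0 DE] : exists2 d, d != 0 & D = d%:P.
    have DE := size1_polyC D1; exists D`_0 => //.
    by apply: contraNneq D0 => D00; rewrite DE D00.
  exists (c2 * d); first by rewrite mulf_neq0.
  move=> g z cz dg Pg; apply: (implicit_jet dg Pg).
  apply: contraNneq cz => P'0.
  have := congr1 (fun p => p.[g z : R[i], z : R[i]]) bez.
  rewrite /= DE; rewrite !(hornerZ, hornerD, hornerM, hornerC).
  by rewrite P'0 (near0 _ _ Pg) !mulr0 addr0 mulr0 => <-.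
have /Pdiv.Idomain.dvdpP[[c Q] /= c0 QD] := dvdp_gcdl P P^`().
have /Pdiv.Idomain.dvdpP[[d E] /= d0 ED] := dvdp_gcdr P P^`().
rewrite -/D in QD ED.
have Q0 : Q != 0.
  apply: contraNneq P0 => Q0; move: QD; rewrite Q0 mul0r => /eqP.
  by rewrite -mul_polyC mulf_eq0 polyC_eq0 (negPf c0).
have sQ : (size Q < n)%N.
  rewrite -sP -(size_scale P c0) QD size_mul //.
  by case: (size D) D1 => [|[|k]] // _; rewrite !addnS ltnS leq_addr.
have [e e0 H] := IH _ sQ Q (erefl _) Q0.
(* Non-vanishing of the leading coefficient keeps P non-zero after specialisation; that of c and d
   keeps the two pseudo-divisions usable. *)
exists (c * d * lead_coef P * e); first by rewrite !mulf_neq0 // lead_coef_eq0.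
move=> g z; rewrite hornerM mulf_eq0 negb_or => /andP[cz ez] dg Pg.
apply: (H g z ez dg).
(* Q has to vanish on a whole neighbourhood of z, so the specialisation is carried out at every
   nearby x. *)
have := cont_at_neq0 (@cont_at_horner (c * d * lead_coef P) z) cz.
move: Pg; apply: (@filterS2 _ (nbhs z) _) => x Px.
rewrite !hornerM !mulf_eq0 !negb_or => /andP[/andP[cx dx] lx].
apply/eqP; rewrite root_horner2E -rootE.
pose ev := map_poly (horner_eval (x : R[i])).
apply: (@root_squarefree_part _ (ev P) _ (ev D) (ev E) c.[x : R[i]] d.[x : R[i]]) => //.
- rewrite -lead_coef_eq0 lead_coef_map_eq // ?/horner_eval //.
- by rewrite /ev -rmorphM -QD /= map_polyZ.
- by rewrite /ev -rmorphM -ED /= map_polyZ deriv_map.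
- by rewrite rootE -root_horner2E Px.
Qed.

Lemma horner_neq0_near (c : {poly R[i]}) z : c != 0 -> exists2 d : R, 0 < d &
  forall w, w != z -> normc (w - z) < d -> c.[w : R[i]] != 0.
Proof.
move=> c0; case: (multiplicity_XsubC c (z : R[i])) => m [W].
rewrite c0 /= => Wz ->.
case: (proj1 (near_normc _ _) (cont_at_neq0 (@cont_at_horner W z) Wz)) => d d0 H.
exists d => // w wz /H Ww.
by rewrite hornerM mulf_neq0 // horner_exp expf_neq0 // hornerXsubC subr_eq0.
Qed.

Lemma Nash_tame g : complex_Nash [set: C] g -> tame g.
Proof.
move=> Ng; have dg z : derivable g z 1.
  by have [U [_ Uz _ dU _]] := Ng z I; exact: dU.
split=> z.
  have [al cal gE] := derivable_slope (dg z).
  have : cont_at (fun x => g z + (x - z) * al (x - z)) z.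
    apply: (@cont_atD _ (fun=> g z) (fun x => (x - z) * al (x - z))).
      by prove_cont_at.
    apply: (@cont_atM _ (fun x => x - z) (fun x => al (x - z))); first by prove_cont_at.
    by apply: (@cont_at_comp _ al (fun x => x - z)); [prove_cont_at|rewrite subrr].
  congr (cont_at _ z); apply/funext => x.
  by rewrite -gE addrC subrK.
have [U [oU Uz _ _ [P [P0 PU]]]] := Ng z I.
have sP0 : swapXY P != 0.
  by apply: contra_neq P0 => sP; rewrite -[P]swapXYK sP raddf0.
have [c c0 H] := algebraic_jet sP0.
have [d d0 cd] := horner_neq0_near z c0.
have [e e0 Ue] := proj1 (near_normc _ _) (open_nbhs_nbhs (conj oU Uz)).
exists (Num.min d e); first by rewrite lt_min d0.
move=> w wz; rewrite lt_min => /andP[wd we].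
apply: (H g w (cd w wz wd) (dg w)).
apply: (@filterS _ (nbhs w) _ _ _ _ (open_nbhs_nbhs (conj oU (Ue w we)))).
by move=> x Ux; rewrite horner2_swapXY PU.
Qed.

End AlgebraicJets.

(** * Maximum principle for tame functions *)

Section MaximumPrinciple.
Variable R : realType.
Local Notation C := (R[i]^o).
Implicit Types (f g : C -> C) (z w : C).

Lemma horner_bound (p : {poly R[i]}) : exists (K : R) (n : nat), 0 <= K /\
  forall z : C, normc p.[z] <= K * (1 + normc z) ^+ n.
Proof.
elim/poly_ind: p => [|p c [K [n [K0 H]]]].
  by exists 0, 0%N; split => // z; rewrite horner0 normc0 mul0r.
exists (K + normc c), n.+1; split; first by rewrite addr_ge0 ?normc_ge0.
move=> z; rewrite hornerMXaddC mulrDl (le_trans (le_normcD _ _)) //.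
have z1 : 1 <= 1 + normc z by rewrite lerDl normc_ge0.
apply: lerD; last by rewrite ler_peMr ?normc_ge0 // exprn_ege1.
rewrite normcM exprSr mulrA ler_pM ?normc_ge0 //.
by rewrite lerDr.
Qed.

Lemma normc_sqr (z : C) : normc z ^+ 2 = complex.Re z ^+ 2 + complex.Im z ^+ 2.
Proof. by case: z => a b; rewrite sqr_sqrtr ?addr_ge0 ?sqr_ge0. Qed.

Lemma normc_real (x : R) : normc (x%:C)%C = `|x|.
Proof. by rewrite /= expr0n addr0 sqrtr_sqr. Qed.

(** Square |q| - |r| <= |q + r| and drop |r|^2; when |q| <= |r| the left side is not positive. *)
Lemma normc_sqr_add_ge (q r : C) :
  normc q ^+ 2 - 2 * normc q * normc r <= normc (q + r) ^+ 2.
Proof.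
have q0 := normc_ge0 q; have r0 := normc_ge0 r; have s0 := normc_ge0 (q + r).
have : normc q <= normc (q + r) + normc r.
  by rewrite -{1}(addrK r q) -(normcN r) le_normcD.
by have [|] := leP (normc q) (normc r); nra.
Qed.

(* The Laplacian of |g|^2 + eps |z|^2 is at least 4 eps; it is read off the
   values at the four points w + i^k h, where the first and second order
   terms of g cancel. *)
Lemma no_local_max g w (eps d : R) : jet g w -> 0 < eps -> 0 < d ->
  (forall z, normc (z - w) < d -> normc (g z) ^+ 2 + eps * normc z ^+ 2
    <= normc (g w) ^+ 2 + eps * normc w ^+ 2) -> False.
Proof.
move=> [a [phi [cphi Hg]]] eps0 d0 M.
pose b := phi 0.
pose K := normc (g w) + normc a + normc b.
have K0 : 0 <= K by rewrite !addr_ge0 ?normc_ge0.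
(* This makes 2 K eta < eps, so the variation of phi costs less than eps |z|^2 gains; the summand 1
   covers K = 0. *)
pose eta := eps / (2 * K + 1).
have eta0 : 0 < eta by rewrite divr_gt0 // ltr_wpDl // mulr_ge0.
have [d1 d10 H1] := proj1 (continuous_normcP _ _) cphi eta eta0.
have [d2 d20 H2] := proj1 (near_normc _ _) Hg.
pose h := Num.min 1 (Num.min d (Num.min d1 d2)) / 2.
have m0 : 0 < Num.min 1 (Num.min d (Num.min d1 d2)).
  by rewrite !lt_min ltr01 d0 d10.
have h0 : 0 < h by rewrite divr_gt0.
have : h < Num.min 1 (Num.min d (Num.min d1 d2)) by rewrite /h; lra.
rewrite !lt_min => /and4P[h1 hd hd1 hd2].
clearbody h; clear m0.
have pt (u : C) : normc u = 1 ->
    normc (g w + a * (u * h%:C%C) + b * (u * h%:C%C) ^+ 2) ^+ 2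
      - 2 * K * eta * h ^+ 2 + eps * normc (w + u * h%:C%C) ^+ 2
    <= normc (g w) ^+ 2 + eps * normc w ^+ 2.
  move=> u1.
  have nuh : normc (u * h%:C%C) = h by rewrite normcM u1 mul1r normc_real gtr0_norm.
  have := M (w + u * h%:C%C); rewrite addrC addKr nuh => /(_ hd).
  apply: le_trans; rewrite lerD2r.
  have := H2 (u * h%:C%C); rewrite subr0 nuh => /(_ hd2) ->.
  have := H1 (u * h%:C%C); rewrite subr0 nuh => /(_ hd1).
  set v := u * h%:C%C; rewrite -/b => phib.
  have -> : g w + a * v + v ^+ 2 * phi v
    = (g w + a * v + b * v ^+ 2) + v ^+ 2 * (phi v - b) by ring.
  set q := _ + b * _; apply: le_trans (normc_sqr_add_ge _ _).
  rewrite lerD2l lerN2 normcM normcX nuh.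
  have qK : normc q <= K.
    apply: le_trans (le_normcD _ _) _; rewrite lerD //.
      apply: le_trans (le_normcD _ _) _; rewrite lerD // normcM nuh.
      by rewrite ler_piMr ?normc_ge0 // ltW.
    by rewrite normcM normcX nuh ler_piMr ?normc_ge0 // exprn_ile1 // ltW.
  have -> : 2 * K * eta * h ^+ 2 = (2 * K) * (h ^+ 2 * eta) by ring.
  apply: ler_pM.
  - by rewrite mulr_ge0 ?normc_ge0.
  - by apply: mulr_ge0; [exact: sqr_ge0|exact: normc_ge0].
  - by rewrite ler_wpM2l.
  - by rewrite ler_wpM2l ?sqr_ge0 // ltW.
have n1 : normc (1 : C) = 1 by rewrite normc1.
have nN1 : normc (- 1 : C) = 1 by rewrite normcN normc1.
have ni : normc ('i%C : C) = 1 by rewrite /= expr0n expr1n add0r sqrtr1.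
have nNi : normc (- 'i%C : C) = 1 by rewrite normcN ni.
move: (pt _ n1) (pt _ nN1) (pt _ ni) (pt _ nNi) => {pt n1 nN1 ni nNi}.
have Keta : 2 * K * eta < eps.
  rewrite /eta mulrA ltr_pdivrMr ?ltr_wpDl ?mulr_ge0 //; lra.
have h20 : 0 < h ^+ 2 by rewrite exprn_gt0.
have : 2 * K * eta * h ^+ 2 < eps * h ^+ 2 by rewrite ltr_pM2r.
have : 0 <= normc a ^+ 2 * h ^+ 2 by rewrite mulr_ge0 ?sqr_ge0.
have : 0 <= normc b ^+ 2 * h ^+ 4 by rewrite mulr_ge0 ?sqr_ge0 // exprn_ge0 // ltW.
rewrite !normc_sqr.
case: (g w) => g1 g2; case: (a) => a1 a2; case: (b) => b1 b2; case: (w) => w1 w2.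
clear -h0.
move: (2 * K * eta * h ^+ 2) => L; rewrite !expr2 /=.
clear => H1 H2 H3 H4 H5 H6 H7.
nra.
Qed.

(** On the compact disc |g|^2 + eps |z|^2 attains its maximum. [no_local_max] excludes interior
    points with a jet; on the circle and at zeros of g the value is at most B^2 + eps rho^2. Then
    eps tends to 0. *)
Lemma max_principle_jet g (rho B : R) :
  (forall z, cont_at g z) ->
  (forall z, normc z = rho -> normc (g z) <= B) ->
  (forall z, normc z < rho -> g z = 0 \/ jet g z) ->
  0 <= B -> forall z, normc z <= rho -> normc (g z) <= B.
Proof.
move=> cg bd jg B0 z0 z0rho.
suff H (eps : R) : 0 < eps -> normc (g z0) ^+ 2 <= B ^+ 2 + eps * rho ^+ 2.
  rewrite -(ler_pXn2r (n := 2)) ?nnegrE ?normc_ge0 //.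
  apply/ler_addgt0Pr => e e0.
  have r0 : 0 < rho ^+ 2 + 1 by rewrite ltr_wpDl ?sqr_ge0.
  apply: le_trans (H (e / (rho ^+ 2 + 1)) _) _; first by rewrite divr_gt0.
  rewrite lerD2l -mulrA ler_piMr ?(ltW e0) //.
  by rewrite mulrC ler_pdivrMr // mul1r lerDl.
move=> eps0.
pose u (z : C) : R := normc (g z) ^+ 2 + eps * normc z ^+ 2.
have cu : continuous u.
  move=> z; apply: (@cvgD _ _ _ (nbhs z)); last first.
    apply: (@cvgM _ _ (nbhs z)); first exact: cvg_cst.
    by apply: (@cvgM _ _ (nbhs z)); exact: normc_continuous.
  have H : (normc (g w) : R) @[w --> z] --> normc (g z).
    apply: (@continuous_comp _ _ _ g (fun z : C => normc z : R)); first exact: cg.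
    exact: normc_continuous.
  exact: (@cvgM _ _ (nbhs z)).
have [|w wD max] := compact_EVT_max _ (@disc_compact R rho) (continuous_subspaceT cu).
  by exists z0.
have {}wD : normc w <= rho by move: wD; rewrite inE.
have {}max z : normc z <= rho -> u z <= u w.
  by move=> zr; apply: max; rewrite inE.
apply: le_trans (_ : u w <= _).
  by apply: le_trans (max _ z0rho); rewrite /u lerDl mulr_ge0 ?sqr_ge0 // ltW.
rewrite /u; have rho0 : 0 <= rho := le_trans (normc_ge0 _) wD.
have : eps * normc w ^+ 2 <= eps * rho ^+ 2.
  by rewrite ler_pM2l // ler_pXn2r ?nnegrE ?normc_ge0.
move: wD; rewrite le_eqVlt => /orP[/eqP wr|wr]; last case: (jg w wr) => [->|jw].
- by move=> H; rewrite lerD // ler_pXn2r ?nnegrE ?normc_ge0 ?bd.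
- by move=> H; rewrite normc0 expr0n lerD ?sqr_ge0.
exfalso; apply: (no_local_max jw eps0 (d := rho - normc w)).
  by rewrite subr_gt0.
move=> z zw; apply: max.
by rewrite -(subrK w z) (le_trans (le_normcD _ _)) // -lerBrDr ltW.
Qed.

(** By compactness finitely many of the neighbourhoods given by tameness cover the disc; Q vanishes
    exactly at their centres. *)
Lemma tame_finite_exceptions g rho : tame g ->
  exists2 Q : {poly R[i]}, Q != 0 &
    forall z, normc z <= rho -> Q.[z : R[i]] != 0 -> jet g z.
Proof.
move=> [_ jg].
have /choice[d Hd] : forall z : C, exists d : R, 0 < d /\
    forall w, w != z -> normc (w - z) < d -> jet g w.
  by move=> z; have [d d0 H] := jg z; exists d.
pose f (z : C) : set C := [set w : C | normc (w - z) < d z].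
have := @disc_compact R rho; rewrite compact_cover => /(_ C setT f).
case.
- move=> z _; rewrite openE => w /= wz.
  apply: (proj2 (near_normc _ _)); exists (d z - normc (w - z)).
    by rewrite subr_gt0.
  move=> x xw; rewrite /f /= -(subrK w x) -addrA (le_lt_trans (le_normcD _ _)) //.
  by rewrite -ltrBrDr.
- move=> z _; exists z => //; rewrite /f /= subrr normc0.
  by have [] := Hd z.
move=> s _ cov; exists (\prod_(x <- finmap.enum_fset s) ('X - (x : R[i])%:P)).
  by rewrite prodf_seq_neq0; apply/allP => x _; rewrite polyXsubC_eq0.
move=> z /cov[x /= xs zx] Qz; have [_ H] := Hd x; apply: (H z) => //.
apply: contra_neq Qz => ->; apply/eqP; rewrite -rootE root_prod_XsubC.
exact: xs.
Qed.

Lemma Bernoulli_ineq (t : R) n : 1 <= t -> 1 + (t - 1) * n%:R <= t ^+ n.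
Proof.
move=> t1; elim: n => [|n IH]; first by rewrite mulr0 addr0.
have n0 : 0 <= n%:R :> R by [].
have : 0 <= (t - 1) * (t - 1) * n%:R by rewrite !mulr_ge0 ?subr_ge0.
have : t * (1 + (t - 1) * n%:R) <= t * t ^+ n by rewrite ler_wpM2l // (le_trans ler01).
rewrite exprS -natr1; nra.
Qed.

Lemma expr_unbounded (t K : R) : 1 < t -> exists m, K < t ^+ m.
Proof.
move=> t1; have t10 : 0 < t - 1 by rewrite subr_gt0.
exists (Num.bound (`|K| / (t - 1))).
apply: lt_le_trans (Bernoulli_ineq _ (ltW t1)).
have : `|K| / (t - 1) < (Num.bound (`|K| / (t - 1)))%:R.
  by rewrite archi_boundP // divr_ge0 // ltW.
rewrite ltr_pdivrMr // mulrC => H.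
by rewrite (le_lt_trans (ler_norm K)) // (lt_trans H) // ltrDr.
Qed.

(* At the exceptional points jets are missing; multiplying g^m by a
   polynomial Q vanishing there restores the maximum principle, and the
   factor Q disappears after taking m-th roots. *)
Lemma max_principle g (rho B : R) : tame g -> 0 < rho -> 0 <= B ->
  (forall z, normc z = rho -> normc (g z) <= B) ->
  forall z, normc z <= rho -> normc (g z) <= B.
Proof.
move=> tg rho0 B0 bd z zr.
have [Q Q0 jQ] := tame_finite_exceptions rho tg.
have [K [n [K0 HK]]] := horner_bound Q.
pose q := K * (1 + rho) ^+ n.
have generic x : normc x <= rho -> Q.[x : R[i]] != 0 -> normc (g x) <= B.
  move=> xr Qx; rewrite leNgt; apply/negP => Bg.
  (* The midpoint is positive even for B = 0, and |g x| / B' > 1 has unbounded powers. *)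
  pose B' := (B + normc (g x)) / 2.
  have BB' : B <= B' by rewrite /B'; lra.
  have B'g : B' < normc (g x) by rewrite /B'; lra.
  have B'0 : 0 < B' by rewrite /B'; lra.
  have mp m : normc (g x ^+ m * Q.[x : R[i]]) <= B' ^+ m * q.
    apply: (@max_principle_jet (fun x => g x ^+ m * Q.[x : R[i]]) rho) => //.
    - by case: (tameM (tameX m tg) (tame_horner Q)).
    - move=> y yr; rewrite normcM normcX ler_pM ?exprn_ge0 ?normc_ge0 //.
        by rewrite lerXn2r ?nnegrE ?normc_ge0 ?(ltW B'0) // (le_trans (bd _ yr)).
      by rewrite /q -yr; exact: HK.
    - move=> y yr; have [->|Qy] := eqVneq Q.[y : R[i]] 0.
        by left; rewrite mulr0.
      right; apply: jetM; last exact: jet_horner.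
      have jy := jQ _ (ltW yr) Qy.
      elim: m => [|m IH]; first exact: jet_cst.
      by under eq_fun do rewrite exprS; exact: (jetM jy IH).
    by rewrite mulr_ge0 ?exprn_ge0 ?(ltW B'0) // mulr_ge0 // exprn_ge0 // addr_ge0 // ltW.
  pose t := normc (g x) / B'.
  have t1 : 1 < t by rewrite ltr_pdivlMr // mul1r.
  have Qx0 : 0 < normc Q.[x : R[i]] by rewrite normc_gt0.
  have tm m : t ^+ m <= q / normc Q.[x : R[i]].
    rewrite ler_pdivlMr // expr_div_n mulrAC ler_pdivrMr ?exprn_gt0 //.
    by have := mp m; rewrite normcM normcX [q * _]mulrC.
  have [m] := expr_unbounded (q / normc Q.[x : R[i]]) t1.
  by rewrite ltNge tm.
have [/eqP zr'|zr'] := eqVneq (normc z) rho; first exact/bd/eqP.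
rewrite leNgt; apply/negP => Bg.
have [cg _] := tg.
have [|d d0 Hd] := proj1 (continuous_normcP _ _) (cg z) (normc (g z) - B).
  by rewrite subr_gt0.
have [e e0 He] := horner_neq0_near z Q0.
have zlt : normc z < rho by rewrite lt_neqAle zr' zr.
(* At a zero of Q the bound follows by continuity: z + h stays in the disc, avoids the zeros of Q,
   and changes g by less than |g z| - B. *)
pose m := Num.min (rho - normc z) (Num.min d e).
have m0 : 0 < m by rewrite !lt_min subr_gt0 zlt d0.
pose h := m / 2.
have h0 : 0 < h by rewrite divr_gt0.
have : h < m by rewrite /h; lra.
rewrite !lt_min => /and3P[h1 h2 h3].
have nh : normc (z + h%:C%C - z) = h.
  by rewrite addrAC subrr add0r normc_real gtr0_norm.
have := generic (z + h%:C%C).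
rewrite (le_trans (le_normcD _ _)); last first.
  by rewrite normc_real gtr0_norm // addrC -lerBrDr ltW.
rewrite He ?nh //; last first.
  by rewrite -subr_eq0 -normc_gt0 nh.
move=> /(_ isT isT) gB.
have := Hd (z + h%:C%C); rewrite nh => /(_ h2).
have := le_normcD (g z - g (z + h%:C%C)) (g (z + h%:C%C)).
rewrite subrK -[normc (g z - _)]normcN opprB => H1 H2.
lra.
Qed.

End MaximumPrinciple.

(** * Identity theorem, growth of algebraic functions and Liouville's theorem *)

Section Liouville.
Variable R : realType.
Local Notation C := (R[i]^o).
Implicit Types (f g : C -> C) (z w : C).

Lemma disc_bounded g (rho : R) : (forall z, cont_at g z) ->
  exists2 M : R, 0 <= M & forall z, normc z <= rho -> normc (g z) <= M.
Proof.
move=> cg; have [rho0|rho0] := ltP rho 0.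
  exists 0 => // z zr.
  by have := le_lt_trans (normc_ge0 z) (le_lt_trans zr rho0); rewrite ltxx.
have cu : continuous (fun z : C => normc (g z) : R).
  move=> z; apply: (@continuous_comp _ _ _ g (fun z : C => normc z : R)).
    exact: cg.
  exact: normc_continuous.
have [|w _ max] := compact_EVT_max _ (@disc_compact R rho) (continuous_subspaceT cu).
  by exists 0; rewrite /disc /mkset normc0.
exists (normc (g w)); first exact: normc_ge0.
by move=> z zr; apply: max; rewrite inE.
Qed.

(** Each quotient vanishes near 0, at 0 itself by continuity, so it has the zero jet there and can
    be divided by z once more. *)
Lemma tame_divX g r m : tame g -> 0 < r ->
  (forall z, normc z < r -> g z = 0) ->
  exists gm, [/\ tame gm, forall z, normc z < r -> gm z = 0 &
    forall z, g z = z ^+ m * gm z].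
Proof.
move=> tg r0 g0; elim: m => [|m [gm [tgm gm0 gE]]].
  by exists g; split => // z; rewrite expr0 mul1r.
have j0 : jet gm 0.
  apply: (@jet_near _ (fun=> 0)); last exact: jet_cst.
  apply: (proj2 (near_normc _ _)); exists r => // z; rewrite subr0 => zr.
  by rewrite gm0.
have [h th hE] := tame_quotient tgm j0.
have {}hE z : gm z = z * h z by rewrite hE gm0 ?normc0 // add0r subr0.
have hz z : z != 0 -> normc z < r -> h z = 0.
  by move=> z0 /gm0/eqP; rewrite hE mulf_eq0 (negPf z0) => /eqP.
exists h; split => // [z zr|z]; last by rewrite gE hE exprSr mulrA.
have [->{z zr}|z0] := eqVneq z 0; last exact: hz.
apply/eqP; apply: contraT => h0.
case: (proj1 (near_normc _ _) (cont_at_neq0 (th.1 0) h0)) => d d0 H.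
pose e := Num.min d r / 2.
have m0 : 0 < Num.min d r by rewrite lt_min d0.
have e0 : 0 < e by rewrite divr_gt0.
have : e < Num.min d r by rewrite /e; lra.
rewrite lt_min => /andP[ed er].
have ne : normc (e%:C%C) = e by rewrite normc_real gtr0_norm.
have := H e%:C%C; rewrite subr0 ne => /(_ ed).
by rewrite hz ?eqxx ?ne // -normc_gt0 ne.
Qed.

(* Schwarz-type estimate: g / z^m is still tame, so the maximum principle
   gives |g z| <= M (|z| / rho)^m for every m. *)
Lemma identity_theorem g r : tame g -> 0 < r ->
  (forall z, normc z < r -> g z = 0) -> forall z, g z = 0.
Proof.
move=> tg r0 g0 z; apply/eqP; apply: contraT => gz.
have z0 : 0 < normc z.
  by rewrite normc_gt0; apply: contraNneq gz => ->; rewrite g0 ?normc0.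
pose rho := normc z + 1.
have rho0 : 0 < rho by rewrite addr_gt0.
have [M M0 HM] := disc_bounded rho tg.1.
have t1 : 1 < rho / normc z by rewrite ltr_pdivlMr // mul1r ltrDl.
have [m] := expr_unbounded (M / normc (g z)) t1.
rewrite ltNge => /negP[].
have [gm [tgm _ gE]] := tame_divX m tg r0 g0.
have bd : normc (gm z) <= M / rho ^+ m.
  apply: (@max_principle _ gm rho) => //.
  - by rewrite divr_ge0 // exprn_ge0 // ltW.
  - move=> w wr; rewrite ler_pdivlMr ?exprn_gt0 // -wr -normcX -normcM mulrC.
    by rewrite -gE HM // wr.
  - by rewrite lerDl.
rewrite ler_pdivlMr ?normc_gt0 // gE normcM normcX expr_div_n mulrA.
rewrite divfK ?expf_neq0 ?gt_eqF //.
by rewrite mulrC -ler_pdivlMr // exprn_gt0.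
Qed.

Lemma le_normc_sum n (F : 'I_n -> C) :
  normc (\sum_i F i) <= \sum_i normc (F i).
Proof.
elim/big_ind2: _ => [|x y x' y' h h'|//]; first by rewrite normc0.
exact: le_trans (le_normcD _ _) (lerD h h').
Qed.

Lemma poly_sum_bound (F : nat -> {poly R[i]}) n : exists (K : R) (N : nat),
  0 <= K /\ forall z : C, \sum_(i < n) normc (F i).[z] <= K * (1 + normc z) ^+ N.
Proof.
elim: n => [|n [K [N [K0 IH]]]].
  by exists 0, 0%N; split => // z; rewrite big_ord0 mul0r.
have [L [M [L0 HL]]] := horner_bound (F n).
exists (K + L), (maxn N M); split=> [|z]; first exact: addr_ge0.
have z1 : 1 <= 1 + normc z by rewrite lerDl normc_ge0.
rewrite big_ord_recr /= mulrDl lerD //.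
  by apply: le_trans (IH z) _; rewrite ler_wpM2l // ler_weXn2l // leq_maxl.
by apply: le_trans (HL z) _; rewrite ler_wpM2l // ler_weXn2l // leq_maxr.
Qed.

(** Split p into linear factors: each z - x has modulus at least 1 once |z| >= |x| + 1, so the
    leading coefficient supplies c. *)
Lemma poly_lower_bound (p : {poly R[i]}) : p != 0 -> exists (c r : R),
  0 < c /\ forall z : C, r <= normc z -> c <= normc p.[z].
Proof.
move=> p0; have [s sE] := closed_field_poly_normal p.
have [r Hr] : exists r : R, forall z : C, r <= normc z ->
    1 <= normc (\prod_(x <- s) ('X - x%:P)).[z].
  elim: s {sE} => [|x s [r IH]].
    by exists 0 => z _; rewrite big_nil hornerC normc1.
  exists (Num.max r (normc x + 1)) => z; rewrite ge_max => /andP[zr zx].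
  rewrite big_cons hornerM normcM hornerXsubC -[leLHS]mulr1 ler_pM ?IH //.
  have := le_normcD (z - x) x; rewrite subrK; lra.
exists (normc (lead_coef p)), r; split.
  by rewrite normc_gt0 lead_coef_eq0.
move=> z /Hr; rewrite [X in _ -> _ <= normc X.[_]]sE hornerZ normcM.
by move=> H; rewrite ler_peMr ?normc_ge0.
Qed.

(** This is the classical root bound: a root t with |t| > 1 of a polynomial of degree d with
    coefficients p_i satisfies |p_d| |t| <= sum of |p_i| over i < d. Here p_d is bounded below for
    large z. *)
Lemma algebraic_growth (P : {poly {poly R[i]}}) g : P != 0 ->
  (forall z, P.[g z : R[i], z : R[i]] = 0) ->
  exists (K r : R) (N : nat), 0 <= K /\
    forall z, r <= normc z -> normc (g z) <= K * (1 + normc z) ^+ N.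
Proof.
move=> P0 Pg; have lP0 : lead_coef P != 0 by rewrite lead_coef_eq0.
have [c [r [c0 Hr]]] := poly_lower_bound lP0.
have [d sP] : exists d, size P = d.+1.
  by exists (size P).-1; rewrite prednK ?size_poly_gt0.
have [K [N [K0 HK]]] := poly_sum_bound (fun i => P`_i) d.
exists (1 + K / c), r, N; split; first by rewrite addr_ge0 // divr_ge0 // ltW.
move=> z /Hr; rewrite lead_coefE sP /= => cz.
have zN : 1 <= (1 + normc z) ^+ N by rewrite exprn_ege1 // lerDl normc_ge0.
have [g1|g1] := leP (normc (g z)) 1.
  by apply: le_trans g1 _; rewrite -[leLHS]mulr1 ler_pM // lerDl divr_ge0 // ltW.
have gn : normc (P`_d).[z : R[i]] * normc (g z) ^+ d <=
    (\sum_(i < d) normc (P`_i).[z : R[i]]) * normc (g z) ^+ d.-1.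
  have := Pg z; rewrite root_horner2E (@horner_coef_wide _ d.+1); last first.
    by rewrite -sP size_poly.
  rewrite big_ord_recr /= !coef_map /= => /eqP.
  rewrite addrC addr_eq0 => /eqP E.
  rewrite -normcX -normcM -[(P`_d).[_]]/(horner_eval _ _) E normcN.
  rewrite (le_trans (le_normc_sum _)) // mulr_suml.
  apply: ler_sum => i _; rewrite coef_map /= normcM normcX.
  apply: ler_wpM2l; first exact: normc_ge0.
  apply: (ler_weXn2l (ltW g1)).
  by rewrite -ltnS prednK // (leq_ltn_trans _ (ltn_ord i)).
(* For d = 0 the estimate reads |p_0(z)| <= 0, against the lower bound c. *)
case: d => [|d] in sP HK cz gn *.
  by move: gn; rewrite big_ord0 mul0r expr0 mulr1 leNgt (lt_le_trans c0 cz).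
have {}gn : normc (g z) <= (\sum_(i < d.+1) normc (P`_i).[z : R[i]]) / c.
  move: gn; rewrite /= exprS mulrA ler_pM2r ?exprn_gt0 ?(lt_trans _ g1) // => gn.
  rewrite ler_pdivlMr // mulrC (le_trans _ gn) // ler_wpM2r ?normc_ge0 //.
apply: le_trans gn _; rewrite mulrDl mul1r mulrAC.
apply: le_trans (_ : K * (1 + normc z) ^+ N / c <= _).
  by rewrite ler_pM2r ?invr_gt0.
by rewrite lerDr (le_trans ler01).
Qed.

(** The extra factor |z| shifts the exponent by one: N = 0 means decay at infinity, which forces g =
    0 by the maximum principle. Passing to a difference quotient lowers N by one. *)
Lemma Liouville_poly N g : tame g ->
  (exists K r : R, forall z, r <= normc z ->
     normc z * normc (g z) <= K * normc z ^+ N) ->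
  exists p : {poly R[i]}, forall z, g z = p.[z].
Proof.
elim: N g => [|N IH] g tg [K [r Kr]].
  exists 0 => z; rewrite horner0; apply/eqP; apply: contraT => gz.
  have gz0 : 0 < normc (g z) by rewrite normc_gt0.
  (* Beyond |z| and |r|, rho exceeds |K| / |g z|, which contradicts the bound |g z| <= |K| / rho. *)
  pose rho := `|r| + normc z + `|K| / normc (g z) + 1.
  have q0 : 0 <= `|K| / normc (g z) by rewrite divr_ge0 ?normc_ge0.
  have r0 : 0 <= `|r| by []. have z0 := normc_ge0 z.
  have rho0 : 0 < rho by rewrite /rho; lra.
  have : normc (g z) <= `|K| / rho.
    apply: (@max_principle _ g rho) => //.
    - by rewrite divr_ge0 // ltW.
    - move=> w wr; rewrite ler_pdivlMr // -wr mulrC.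
      have := Kr w; rewrite expr0 mulr1 => H; rewrite (le_trans (H _)) ?ler_norm //.
      rewrite wr (le_trans (ler_norm r)) // /rho; lra.
    - by rewrite /rho; lra.
  rewrite ler_pdivlMr // -ler_pdivlMl // mulrC /rho leNgt => /negP[].
  by rewrite mulrC; lra.
have [d d0 jg] := tg.2 0.
(* A jet at 0 is not guaranteed, so the base point is a nearby w. For |z| >= d one has |w| <= |z| /
   2, whence |z| <= 2 |z - w|. *)
pose w : C := (d / 2)%:C%C.
have d20 : 0 < d / 2 by rewrite divr_gt0.
have nw : normc w = d / 2 by rewrite normc_real gtr0_norm.
have [|g1 tg1 gE] := tame_quotient tg (_ : jet g w).
  by apply: jg; rewrite ?subr0 -?normc_gt0 nw //; lra.
have [|p pE] := IH g1 tg1; last first.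
  exists ((g w : R[i])%:P + ('X - (w : R[i])%:P) * p) => z.
  by rewrite hornerD hornerC hornerM hornerXsubC gE pE.
exists (2 * (K + normc (g w))), (`|r| + d + 1) => z zr.
have r0 : 0 <= `|r| by [].
have zr1 : r <= normc z by have := ler_norm r; lra.
have z1 : 1 <= normc z by lra.
have z0 : 0 < normc z by lra.
have zw : normc z <= 2 * normc (z - w).
  have := le_normcD (z - w) w; rewrite subrK nw; lra.
have {Kr zr1} gz : normc (g z) <= K * normc z ^+ N.
  by have := Kr z zr1; rewrite exprS mulrCA ler_pM2l.
have E : normc (z - w) * normc (g1 z) <= normc (g z) + normc (g w).
  rewrite -normcM -(normcN (g w)) (le_trans _ (le_normcD _ _)) //.
  by rewrite gE addrAC subrr add0r.
have zN : 1 <= normc z ^+ N by rewrite exprn_ege1.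
have gw : normc (g w) <= normc (g w) * normc z ^+ N by rewrite ler_peMr ?normc_ge0.
apply: le_trans (_ : 2 * normc (z - w) * normc (g1 z) <= _).
  by rewrite ler_wpM2r ?normc_ge0.
rewrite -!mulrA ler_pM2l // mulrDl; lra.
Qed.

Lemma Nash_polynomial g : complex_Nash [set: C] g ->
  exists p : {poly R[i]}, forall z, g z = p.[z].
Proof.
move=> Ng; have tg := Nash_tame Ng.
have [U [oU U0 _ _ [Q [Q0 QU]]]] := Ng 0 I.
pose P := swapXY Q.
have P0 : P != 0.
  by apply: contra_neq Q0 => sQ; rewrite -[Q]swapXYK -/P sQ raddf0.
have [e e0 Ue] := proj1 (near_normc _ _) (open_nbhs_nbhs (conj oU U0)).
have Pg := @identity_theorem (fun z => P.[g z : R[i], z : R[i]]) e (tame_horner2 P tg) e0.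
have {}Pg z : P.[g z : R[i], z : R[i]] = 0.
  apply: Pg => w we; rewrite horner2_swapXY; apply: QU.
  by apply: Ue; rewrite subr0.
have [K [r [N [K0 H]]]] := algebraic_growth P0 Pg.
(* For |z| >= 1 one has 1 + |z| <= 2 |z|, which yields 2^N; the exponent N+1 absorbs the factor
   |z|. *)
apply: (@Liouville_poly N.+1 g tg); exists (K * 2 ^+ N), (Num.max r 1) => z.
rewrite ge_max => /andP[/H gz z1].
rewrite exprS mulrCA ler_pM2l ?(lt_le_trans ltr01) //.
apply: le_trans gz _; rewrite -mulrA ler_wpM2l // -exprMn.
rewrite lerXn2r ?nnegrE; lra.
Qed.

End Liouville.

(** * Algebraic laws of the Cayley-Dickson algebras *)

Section StarAlgebras.
Variable R : realType.

(** These laws are inherited by the Cayley-Dickson double; associativity, which fails for the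
    octonions, is not among them. Trace and norm are stated as real multiples of the unit. *)
Record star_algebra_laws (A : starAlg R) : Prop := StarAlgebraLaws {
  sa_mulDl : forall x y z : A, sa_mul (x + y) z = sa_mul x z + sa_mul y z;
  sa_mulDr : forall x y z : A, sa_mul x (y + z) = sa_mul x y + sa_mul x z;
  sa_mulZl : forall (a : R) (x y : A), sa_mul (a *: x) y = a *: sa_mul x y;
  sa_mulZr : forall (a : R) (x y : A), sa_mul x (a *: y) = a *: sa_mul x y;
  sa_mul1l : forall x : A, sa_mul sa_one x = x;
  sa_mul1r : forall x : A, sa_mul x sa_one = x;
  sa_conjD : forall x y : A, sa_conj (x + y) = sa_conj x + sa_conj y;
  sa_conjZ : forall (a : R) (x : A), sa_conj (a *: x) = a *: sa_conj x;
  sa_conjK : forall x : A, sa_conj (sa_conj x) = x;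
  sa_conj1 : sa_conj sa_one = sa_one :> A;
  sa_trace : forall x : A, exists t : R, x + sa_conj x = t *: sa_one;
  sa_norm : forall x : A, exists n : R, [/\ 0 <= n, n = 0 -> x = 0,
    sa_mul x (sa_conj x) = n *: sa_one & sa_mul (sa_conj x) x = n *: sa_one] }.

Lemma sa_mulNl (A : starAlg R) : star_algebra_laws A ->
  forall x y : A, sa_mul (- x) y = - sa_mul x y.
Proof. by move=> lA x y; rewrite -scaleN1r sa_mulZl // scaleN1r. Qed.

Lemma sa_mulNr (A : starAlg R) : star_algebra_laws A ->
  forall x y : A, sa_mul x (- y) = - sa_mul x y.
Proof. by move=> lA x y; rewrite -scaleN1r sa_mulZr // scaleN1r. Qed.

Lemma sa_mul0l (A : starAlg R) : star_algebra_laws A ->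
  forall x : A, sa_mul 0 x = 0.
Proof. by move=> lA x; rewrite -(scale0r x) sa_mulZl // !scale0r. Qed.

Lemma sa_mul0r (A : starAlg R) : star_algebra_laws A ->
  forall x : A, sa_mul x 0 = 0.
Proof. by move=> lA x; rewrite -(scale0r x) sa_mulZr // !scale0r. Qed.

Lemma sa_conjN (A : starAlg R) : star_algebra_laws A ->
  forall x : A, sa_conj (- x) = - sa_conj x.
Proof. by move=> lA x; rewrite -scaleN1r sa_conjZ // scaleN1r. Qed.

Lemma sa_conj0 (A : starAlg R) : star_algebra_laws A -> sa_conj 0 = 0 :> A.
Proof. by move=> lA; rewrite -(scale0r 0) sa_conjZ // !scale0r. Qed.

Lemma real_starAlg_laws : star_algebra_laws (real_starAlg R).
Proof.
split => //=.
- by move=> x y z; rewrite mulrDl.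
- by move=> x y z; rewrite mulrDr.
- by move=> a x y; rewrite /GRing.scale /= mulrA.
- by move=> a x y; rewrite /GRing.scale /= mulrCA.
- by move=> x; rewrite mul1r.
- by move=> x; rewrite mulr1.
- by move=> x; exists (x + x); rewrite /GRing.scale /= mulr1.
- move=> x; exists (x * x); rewrite /GRing.scale /= mulr1; split=> //.
  + by rewrite -expr2 sqr_ge0.
  + by move=> /eqP; rewrite mulf_eq0 orbb => /eqP.
Qed.

(** The trace of (a, b) is that of a, and its norm is the sum of the norms of a and b, so positivity
    persists. *)
Lemma cayley_dickson_laws (A : starAlg R) :
  star_algebra_laws A -> star_algebra_laws (cayley_dickson A).
Proof.
move=> lA; split => /=.
- move=> [a b] [c d] [e f]; congr pair => /=.
    by rewrite sa_mulDl // (sa_mulDr lA) opprD addrACA.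
  by rewrite sa_mulDr // sa_mulDl // addrACA.
- move=> [a b] [c d] [e f]; congr pair => /=.
    by rewrite sa_conjD // sa_mulDl // (sa_mulDr lA) opprD addrACA.
  by rewrite sa_conjD // sa_mulDl // (sa_mulDr lA) addrACA.
- move=> r [a b] [c d]; congr pair => /=.
    by rewrite sa_mulZl // (sa_mulZr lA) -scalerBr.
  by rewrite sa_mulZl // (sa_mulZr lA) -scalerDr.
- move=> r [a b] [c d]; congr pair => /=.
    by rewrite sa_conjZ // sa_mulZl // (sa_mulZr lA) -scalerBr.
  by rewrite sa_conjZ // sa_mulZl // (sa_mulZr lA) -scalerDr.
- move=> [a b]; congr pair => /=.
    by rewrite sa_mul1l // sa_mul0r // subr0.
  by rewrite sa_mul1r // sa_mul0l // addr0.
- move=> [a b]; congr pair => /=.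
    by rewrite sa_mul1r // sa_conj0 // sa_mul0l // subr0.
  by rewrite sa_mul0l // sa_conj1 // sa_mul1r // add0r.
- by move=> [a b] [c d]; congr pair => /=; rewrite ?sa_conjD // opprD.
- by move=> r [a b]; congr pair => /=; rewrite ?sa_conjZ // scalerN.
- by move=> [a b] /=; rewrite sa_conjK // opprK.
- by congr pair; rewrite ?sa_conj1 // oppr0.
- move=> [a b]; have [t tE] := sa_trace lA a; exists t.
  by congr pair => /=; rewrite ?tE // subrr scaler0.
- move=> [a b]; have [n [n0 nz nl nr]] := sa_norm lA a.
  have [m [m0 mz ml mr]] := sa_norm lA b; exists (n + m); split => /=.
  + exact: addr_ge0.
  + move=> /eqP; rewrite paddr_eq0 // => /andP[/eqP/nz -> /eqP/mz ->]; by [].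
  + congr pair => /=.
      by rewrite sa_conjN // sa_mulNl // opprK nl mr scalerDl.
    by rewrite sa_conjK // sa_mulNl // addNr scaler0.
  + congr pair => /=.
      by rewrite sa_mulNr // opprK nr mr scalerDl.
    by rewrite sa_mulNl // subrr scaler0.
Qed.

Lemma alg_laws h : star_algebra_laws (alg R h).
Proof.
by case: h; do ?[apply: cayley_dickson_laws]; exact: real_starAlg_laws.
Qed.

(* For v = x - t/2, where t is the trace of x, the conjugate of v is -v, so
   v v = - n(v). *)
Lemma exists_slice_point (A : starAlg R) : star_algebra_laws A ->
  forall I0 x : A, sa_mul I0 I0 = - sa_one ->
  exists (a b : R) (J : A), sa_mul J J = - sa_one /\ x = a *: sa_one + b *: J.
Proof.
move=> lA I0 x I0E; have [t tE] := sa_trace lA x.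
pose v := x - (t / 2) *: sa_one.
have vC : sa_conj v = - v.
  have cx : sa_conj x = t *: sa_one - x by rewrite -tE addrC addKr.
  rewrite /v sa_conjD // sa_conjN // sa_conjZ // sa_conj1 // cx.
  rewrite opprB addrAC -scalerBl; congr (_ *: _ - _); lra.
have [n [n0 nz nl _]] := sa_norm lA v.
have vv : sa_mul v v = - (n *: sa_one) by rewrite -nl vC sa_mulNr // opprK.
have xE : x = (t / 2) *: sa_one + v by rewrite /v addrC subrK.
(* If n = 0 then x is real and any imaginary unit serves; I0 provides one. *)
have [n_eq0|n_neq0] := eqVneq n 0.
  exists (t / 2), 0, I0; split=> //.
  by rewrite scale0r addr0 {1}xE (nz n_eq0) addr0.
have s0 : 0 < Num.sqrt n by rewrite sqrtr_gt0 lt_neqAle eq_sym n_neq0.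
exists (t / 2), (Num.sqrt n), ((Num.sqrt n)^-1 *: v); split.
  rewrite sa_mulZl // sa_mulZr // vv scalerA scalerN scalerA -invfM -expr2.
  by rewrite sqr_sqrtr // mulVf // scale1r.
by rewrite scalerA divff ?gt_eqF // scale1r.
Qed.

End StarAlgebras.

(** * From polynomial stem components to slice polynomials *)

Section Assembly.
Variable R : realType.
Local Notation C := (R[i]^o).

Lemma Re_sum n (F : 'I_n -> R[i]) :
  complex.Re (\sum_i F i) = \sum_i complex.Re (F i).
Proof. by apply: (big_morph (@complex.Re R)) => [[a b] [c d]|]. Qed.

Lemma Im_sum n (F : 'I_n -> R[i]) :
  complex.Im (\sum_i F i) = \sum_i complex.Im (F i).
Proof. by apply: (big_morph (@complex.Im R)) => [[a b] [c d]|]. Qed.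

(** Termwise, Re (c w) + Re (c conj w) = 2 Re c Re w with w = z^s. *)
Lemma Re_horner_conj (p : {poly R[i]}) n (z : R[i]) : (size p <= n)%N ->
  2^-1 * (complex.Re p.[z] + complex.Re p.[conjc z]) =
  \sum_(s < n) complex.Re p`_s * complex.Re (z ^+ s).
Proof.
move=> pn; rewrite !(horner_coef_wide _ pn) !Re_sum -big_split mulr_sumr.
apply: eq_bigr => s _; rewrite -rmorphXn /=.
by case: (p`_s) => a b; case: (z ^+ s) => c d /=; field.
Qed.

(** Termwise, Im (c w) - Im (c conj w) = 2 Re c Im w. The coefficients are those of
    [Re_horner_conj], which lets both stem components share the same alpha_s. *)
Lemma Im_horner_conj (p : {poly R[i]}) n (z : R[i]) : (size p <= n)%N ->
  2^-1 * (complex.Im p.[z] - complex.Im p.[conjc z]) =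
  \sum_(s < n) complex.Re p`_s * complex.Im (z ^+ s).
Proof.
move=> pn; rewrite !(horner_coef_wide _ pn) !Im_sum -sumrB mulr_sumr.
apply: eq_bigr => s _; rewrite -rmorphXn /=.
by case: (p`_s) => a b; case: (z ^+ s) => c d /=; field.
Qed.

Variable h : HorO.
Local Notation A := (alg R h).
Let lA : star_algebra_laws A := alg_laws R h.

Lemma sa_mul_sumr (x : A) n (F : 'I_n -> A) :
  sa_mul x (\sum_i F i) = \sum_i sa_mul x (F i).
Proof. exact: (big_morph _ (sa_mulDr lA x) (sa_mul0r lA x)). Qed.

Lemma sa_mul_slice_point (J y : A) (a b : R) :
  sa_mul (slice_point J a b) y = a *: y + b *: sa_mul J y.
Proof. by rewrite /slice_point (sa_mulDl lA) !(sa_mulZl lA) (sa_mul1l lA). Qed.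

(** Bilinearity and J J = -1 already make a + ib -> a + bJ multiplicative, so the induction never
    reassociates a product. *)
Lemma sa_exp_slice_point (J : A) (a b : R) n : imaginary_units J ->
  sa_exp (slice_point J a b) n =
  slice_point J (complex.Re ((a +i* b)%C ^+ n)) (complex.Im ((a +i* b)%C ^+ n)).
Proof.
move=> JE; elim: n => [|n IH].
  by rewrite expr0 /slice_point /= scale1r scale0r addr0.
rewrite [LHS]/= IH sa_mul_slice_point {2}/slice_point (sa_mulDr lA).
rewrite !(sa_mulZr lA) (sa_mul1r lA) (_ : sa_mul J J = - sa_one) // exprS.
case: (_ ^+ n) => c d /=; rewrite /slice_point !scalerDr !scalerA !scalerN.
by rewrite [X in _ + X]addrC addrACA scalerBl scalerDl.
Qed.

End Assembly.

Theorem theorem6p1 (R : realType) (h : HorO) (f : alg R h -> alg R h) :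
  slice_Nash [set: R[i]^o] f ->
  exists (n : nat) (alpha : 'I_n.+1 -> alg R h),
    forall x : alg R h, f x = \sum_(s < n.+1) sa_mul (sa_exp x s) (alpha s).
Proof.
have lA := alg_laws R h.
case=> F [[_ _ Fconj] fF _ [I0 [e [I0E _ [phi1 [phi2 [F1 F2 Nphi]]]]]]].
have /choice[p pE] : forall lk : bool * 'I_(u_ h).+1, exists p : {poly R[i]},
    forall z : R[i], (phi1 lk.1 lk.2 z +i* phi2 lk.1 lk.2 z)%C = p.[z].
  by move=> [l k]; have [p pE] := Nash_polynomial (Nphi l k); exists p.
(* Flattening to a real family leaves only real scalars, which commute with the nonassociative
   product. *)
pose E (lk : bool * 'I_(u_ h).+1) := if lk.1 then sa_mul I0 (e lk.2) else e lk.2.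
have FE (phi : bool -> 'I_(u_ h).+1 -> R[i]^o -> R) (z : R[i]^o) :
    \sum_k sa_mul (slice_point I0 (phi false k z) (phi true k z)) (e k)
    = \sum_lk phi lk.1 lk.2 z *: E lk.
  rewrite -(pair_bigA _ (fun l k => phi l k z *: E (l, k))) big_bool /=.
  rewrite -big_split; apply: eq_bigr => k _ /=.
  by rewrite sa_mul_slice_point addrC.
pose n := \max_lk size (p lk).
have pn lk : (size (p lk) <= n.+1)%N by rewrite leqW // (leq_bigmax lk).
(* Only real parts enter, because averaging F z with the conjugate of F (conj z) cancels the
   imaginary parts of the coefficients. *)
pose al (s : 'I_n.+1) := \sum_lk complex.Re (p lk)`_s *: E lk.
have alE (G : nat -> R) :
    \sum_lk (\sum_(s < n.+1) complex.Re (p lk)`_s * G s) *: E lk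
    = \sum_(s < n.+1) G s *: al s.
  under eq_bigr do rewrite scaler_suml.
  rewrite exchange_big; apply: eq_bigr => s _ /=; rewrite scaler_sumr.
  by apply: eq_bigr => lk _; rewrite scalerA mulrC.
have two (V : lmodType R) (v : V) : v = 2^-1 *: (v + v).
  have h2 : 2^-1 + 2^-1 = 1 :> R by field.
  by rewrite scalerDr -scalerDl h2 scale1r.
have F1E (z : R[i]^o) : (F z).1 = \sum_(s < n.+1) complex.Re (z ^+ s) *: al s.
  have FC : (F (conjc z)).1 = (F z).1 by rewrite Fconj.
  rewrite [LHS]two -{2}FC !F1 // !FE -big_split scaler_sumr.
  rewrite -(alE (fun s => complex.Re (z ^+ s))).
  apply: eq_bigr => lk _; rewrite /= -scalerDl scalerA -Re_horner_conj //.
  by rewrite -!pE.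
have F2E (z : R[i]^o) : (F z).2 = \sum_(s < n.+1) complex.Im (z ^+ s) *: al s.
  have FC : - (F (conjc z)).2 = (F z).2 by rewrite Fconj //= opprK.
  rewrite [LHS]two -{2}FC !F2 // !FE -sumrB scaler_sumr.
  rewrite -(alE (fun s => complex.Im (z ^+ s))).
  apply: eq_bigr => lk _; rewrite /= -scalerBl scalerA -Im_horner_conj //.
  by rewrite -!pE.
exists n, al => x.
have [a [b [J [JE ->]]]] := exists_slice_point lA x I0E.
(* With z = a + ib, f x = F_1 + J F_2 is the sum of Re (z^s) alpha_s + J (Im (z^s) alpha_s), and
   each term is x^s alpha_s. *)
rewrite -/(slice_point J a b) fF // F1E F2E sa_mul_sumr -big_split.
apply: eq_bigr => s _ /=.
by rewrite sa_exp_slice_point // sa_mul_slice_point (sa_mulZr lA).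
Qed.
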